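(* Let $p$ be a prime. Then: (1) The closed subgroups of $\mathbf{Z}\{p^n\}$ are $p^m\mathbf{Z}$ ($m=0,1,\dots$) and $\{0\}$. (2) The character group of $\mathbf{Z}\{p^n\}$ is (identified with) $\mathbf{Z}[1/p]/\mathbf{Z}\subset\mathbf{T}$, where $\mathbf{Z}[1/p]$ is the ring generated by $1/p$ over $\mathbf{Z}$. (3) Both of the properties X(1) and X(2) hold for $\mathbf{Z}\{p^n\}$.
   Context: For a prime $p$, $\mathbf{Z}\{p^n\}$ denotes the additive group of integers equipped with the strongest (finest) group topology in which the sequence $(p^n)_{n\in\mathbf{N}}$ converges to $0$. All topological groups here are Hausdorff and Abelian. A character of a topological group is a continuous homomorphism into the torus $\mathbf{T}=\mathbf{R}/\mathbf{Z}$; a character $\chi$ of $\mathbf{Z}\{p^n\}$ is identified with the element $\chi(1)$ of $\mathbf{T}$. A subgroup $H$ of a topological group $G$ is dually closed if for each $g\in G\setminus H$ there is a character $\chi$ of $G$ that is identically zero on $H$ and satisfies $\chi(g)\neq 0$. A subgroup $H$ of $G$ (with the subspace topology) is dually embedded if each character of $H$ extends to a character of $G$. Property X(1): every closed subgroup is dually closed. Property X(2): every closed subgroup is dually embedded. *)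

(* Defs.v *)
From HB Require Import structures.
From mathcomp Require Import all_boot all_order all_algebra.
From mathcomp Require Import generic_quotient ring_quotient.
From mathcomp Require Import finmap ring.
From mathcomp Require Import all_classical all_reals all_analysis.

Set Implicit Arguments.
Unset Strict Implicit.
Unset Printing Implicit Defensive.

Import Order.TTheory GRing.Theory Num.Theory.
Import numFieldNormedType.Exports.

Local Open Scope classical_set_scope.
Local Open Scope ring_scope.
Local Open Scope quotient_scope.

Definition int_subgroup (R : realType) : zmodClosed R :=
  GRing.ZmodClosed.clone R Num.int_num_subdef _.

Definition torus (R : realType) : Type :=
  quotient_topology (Quotient.quot (int_subgroup R)).

Section torus_structure.
Variable R : realType.
Local Notation T := (torus R).
Local Notation I := (int_subgroup R).

HB.instance Definition _ := PointedTopological.on T.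
HB.instance Definition _ := Quotient.on T.
HB.instance Definition _ := GRing.isZmodule.Build T
  (@Quotient.addqA R I) (@Quotient.addqC R I)
  (@Quotient.add0q R I) (@Quotient.addNq R I).

Lemma torus_pi_is_zmod_morphism : zmod_morphism (\pi_T : R -> T).
Proof.
exact: (@pi_is_zmod_morphism _ _ _ (Quotient.quot I)).
Qed.

HB.instance Definition _ :=
  GRing.isZmodMorphism.Build R T (\pi_T : R -> T) torus_pi_is_zmod_morphism.

Lemma torus_pi_eq (x y : R) :
  (\pi_T x = \pi_T y :> T) <-> (x - y \is a Num.int).
Proof.
have E : (x - y \is a Num.int) = (x == y %[mod Quotient.quot I]).
  exact: (Quotient.idealrBE I).
by split=> [xy|]; rewrite E; [apply/eqP; exact: xy | move/eqP].
Qed.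

Lemma torus_pi_open (A : set R) : open A -> open ((\pi_T : R -> T) @` A).
Proof.
move=> oA; rewrite /open/= /quotient_open.
rewrite (_ : _ @^-1` _ = \bigcup_(k : int) ((fun x : R => x - k%:~R) @^-1` A)).
  apply: bigcup_open => k _.
  have /continuousP : continuous (fun x : R => x - k%:~R).
    by move=> x; apply: cvgB; [exact: cvg_id|exact: cvg_cst].
  exact.
apply/seteqP; split => x /=.
  move=> [y Ay /torus_pi_eq/intrP [k yxk]].
  by exists (- k) => //=; rewrite mulrNz opprK -yxk addrC subrK.
move=> [k _ /= Axk]; exists (x - k%:~R) => //.
by apply/torus_pi_eq; rewrite addrC addKr rpredN intr_int.
Qed.

Lemma torus_sub_continuous : continuous (fun x : T * T => x.1 - x.2).
Proof.
move=> [a b] U /=.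
rewrite -[a]reprK -[b]reprK; set x := repr a; set y := repr b => Uxy.
have cpi : continuous (\pi_T : R -> T) by exact: pi_continuous.
have : nbhs (x - y) ((\pi_T : R -> T) @^-1` U).
  by apply: cpi; rewrite raddfB.
move=> /(@sub_continuous R (x, y)) [[/= A B] [Ax By] AB].
rewrite !nbhsE in Ax By.
have [A' [oA A'x] A'A] := Ax; have [B' [oB B'y] B'B] := By.
exists ((\pi_T : R -> T) @` A', (\pi_T : R -> T) @` B').
  split => /=; apply: open_nbhs_nbhs; split; [exact: torus_pi_open| |exact: torus_pi_open|].
  - by exists x.
  - by exists y.
move=> [_ _] /= [[u /A'A Au <-] [v /B'B Bv <-]].
by have := AB (u, v) (conj Au Bv); rewrite /= raddfB.
Qed.

HB.instance Definition _ :=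
  PreTopologicalNmodule_isTopologicalZmodule.Build T torus_sub_continuous.
End torus_structure.

Section characters.
Variables (R : realType) (G : topologicalZmodType).

Definition is_character (f : G -> torus R) : Prop :=
  zmod_morphism f /\ continuous f.

Definition character_pred : pred (G -> torus R) :=
  fun f => `[< is_character f >].

Record character : Type := Character {
  character_fun :> G -> torus R ;
  character_funP : character_pred character_fun }.

HB.instance Definition _ := [isSub for character_fun].
HB.instance Definition _ := [Choice of character by <:].

Lemma character_pred_zmod_closed : zmod_closed character_pred.
Proof.
split=> [|f g /asboolP[fB fC] /asboolP[gB gC]]; apply/asboolP; split.
- by move=> x y; rewrite subrr.
- by move=> x; exact: cvg_cst.
- by move=> x y; rewrite !fctE fB gB !opprD !opprK addrACA.
- move=> x; apply: (@continuous_comp _ _ _ (fun z => (f z, g z))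
    (fun z : torus R * torus R => z.1 - z.2)); last exact: sub_continuous.
  exact: (cvg_pair (fC x) (gC x)).
Qed.

HB.instance Definition _ :=
  GRing.isZmodClosed.Build (G -> torus R) character_pred
    character_pred_zmod_closed.
HB.instance Definition _ := [SubChoice_isSubZmodule of character by <:].

Definition subgroup (H : set G) : Prop := zmod_closed [in H].

Definition dually_closed (H : set G) : Prop :=
  forall g, ~ H g ->
    exists chi : character, (forall h, H h -> chi h = 0) /\ chi g <> 0.

(* Characters of H are represented by total functions on G, whose values
   outside H are irrelevant: {within H, continuous f} refers to the subspace
   topology of H. *)
Definition subgroup_character (H : set G) (f : G -> torus R) : Prop :=
  {in H &, {morph f : x y / x - y}} /\ {within H, continuous f}.

Definition dually_embedded (H : set G) : Prop :=
  forall f, subgroup_character H f ->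
    exists chi : character, forall h, H h -> chi h = f h.

Definition property_X1 : Prop :=
  forall H, subgroup H -> closed H -> dually_closed H.
Definition property_X2 : Prop :=
  forall H, subgroup H -> closed H -> dually_embedded H.

End characters.

(* Z{p^n}, as an alias of int whose topology depends on p *)
Definition Zseq (p : nat) : Type := int.

Section finest.
Variable p : nat.

(* Hausdorff group topologies on int in which p ^ n tends to 0 *)
Definition admissible (T : Topological int) : Prop :=
  let S := Topological.Pack T in
  [/\ hausdorff_space S,
      continuous (fun x : S * S => (x.1 - x.2 : int) : S) &
      (fun n : nat => (p%:Z ^+ n : S)) @ \oo --> (0 : S)].

Local Notation Z := (Zseq p).

(* All the sets that are open for some admissible topology: they generate the
   supremum of the admissible topologies. *)
Definition Zseq_subbase : set (set Z) :=
  [set U : set int | exists2 T : Topological int, admissible T &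
                                        open (U : set (Topological.Pack T))].

HB.instance Definition _ := GRing.Zmodule.copy Z int.
HB.instance Definition _ := isSubBaseTopological.Build Z Zseq_subbase id.

Lemma cvg_Zseq (F : set_system int) (x : int) : Filter F ->
  F --> (x : Z) <->
  forall T, admissible T -> F --> (x : Topological.Pack T).
Proof.
move=> FF; split=> [cvF T aT A|cvF A] /=.
  rewrite (@nbhsE (Topological.Pack T)) => -[B [oB Bx] BA]; apply: cvF.
  exists B; split=> //; exists [set B]; last by rewrite bigcup_set1.
  move=> _ ->; exists [fset B]%fset; last by rewrite set_fset1 bigcap_set1.
  by move=> C; rewrite inE inE => /eqP ->; exists T.
rewrite (@nbhsE Z) => -[_ [[B sB <-] [C BC Cx] UBA]].
apply: filterS UBA _; apply: (@filterS _ _ _ C).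
  by move=> y Cy; exists C.
have /sB [D sD IDC] := BC; rewrite -IDC; apply: filter_bigI => E DE.
have := sD _ DE; rewrite inE => -[T aT oE].
apply: (cvF T aT); apply: open_nbhs_nbhs; split=> //.
by move: Cx; rewrite -IDC => /(_ _ DE).
Qed.

Lemma Zseq_finer (T : Topological int) (x : int) : admissible T ->
  nbhs (x : Topological.Pack T) `<=` nbhs (x : Z).
Proof.
by move=> aT; apply: (@cvg_Zseq (nbhs (x : Z)) x _).1 T aT.
Qed.

Lemma Zseq_sub_continuous : continuous (fun x : Z * Z => x.1 - x.2).
Proof.
move=> [x y]; apply/(@cvg_Zseq _ (x - y)) => T aT.
have [_ subC _] := aT => U /(subC (x, y)) [[/= A B] [Ax By] AB].
by exists (A, B) => //; split; exact: (Zseq_finer aT).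
Qed.

HB.instance Definition _ :=
  PreTopologicalNmodule_isTopologicalZmodule.Build Z Zseq_sub_continuous.

Lemma Zseq_cvg : (fun n : nat => (p%:Z ^+ n : Z)) @ \oo --> (0 : Z).
Proof. by apply/(@cvg_Zseq _ 0) => T []. Qed.

Lemma Zseq_finest (T : Topological int) (U : set int) : admissible T ->
  open (U : set (Topological.Pack T)) -> open (U : set Z).
Proof.
by move=> aT; rewrite !openE => oU x /oU; exact: (Zseq_finer aT).
Qed.
End finest.

(* The p-adic topology is admissible, so that the family of topologies
   defining Zseq p is not empty and Zseq p is Hausdorff. *)
Definition padic (p : nat) : Type := int.

Section padic.
Variable p : nat.

Local Notation P := (padic p).
HB.instance Definition _ := Choice.copy P int.

Definition padic_open (U : set P) : Prop :=
  forall x : int, U x -> exists n : nat, forall k : int, U (x + k * p%:Z ^+ n).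

Lemma padic_openT : padic_open setT. Proof. by move=> x _; exists 0%N. Qed.

Lemma padic_openI : setI_closed padic_open.
Proof.
move=> U V oU oV x [/oU[m Um] /oV[n Vn]]; exists (m + n)%N => k; split.
- by rewrite exprD mulrCA mulrC; exact: Um.
- by rewrite exprD mulrA; exact: Vn.
Qed.

Lemma padic_open_bigU (I : Type) (f : I -> set P) :
  (forall i, padic_open (f i)) -> padic_open (\bigcup_i f i).
Proof.
by move=> of_ x [i _ /of_[n fn]]; exists n => k; exists i => //; exact: fn.
Qed.

HB.instance Definition _ :=
  isOpenTopological.Build P padic_openT padic_openI padic_open_bigU.

Lemma padic_nbhsP (x : int) (A : set P) :
  nbhs (x : P) A <-> exists n : nat, forall k : int, A (x + k * p%:Z ^+ n).
Proof.
split; first by move=> [B [oB /oB[n Bn] BA]]; exists n => k; exact/BA/Bn.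
move=> [n An]; exists [set x + k * p%:Z ^+ n | k in [set: int]]; split.
- move=> _ [k _ <-]; exists n => l; exists (k + l) => //.
  by rewrite mulrDl addrA.
- by exists 0 => //; rewrite mul0r addr0.
- by move=> _ [k _ <-].
Qed.

Lemma padic_admissible : (1 < p)%N -> admissible p (Topological.class P).
Proof.
move=> p1; split.
- move=> a b ab; pose n := `|a - b|%N.
  have [_ [[k _ <-] [l _ kl]]] := ab
    [set a + k * p%:Z ^+ n | k in [set: int]] [set b + l * p%:Z ^+ n | l in [set: int]]
    ((padic_nbhsP _ _).2 (ex_intro _ n (fun k => ex_intro2 _ _ k I erefl)))
    ((padic_nbhsP _ _).2 (ex_intro _ n (fun k => ex_intro2 _ _ k I erefl))).
  have abE : a - b = (l - k) * p%:Z ^+ n.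
    apply: (addIr (b + k * p%:Z ^+ n)).
    by rewrite addrA subrK -kl; ring.
  have [lk|lk] := eqVneq (l - k) 0.
    by apply/eqP; rewrite -subr_eq0 abE lk mul0r.
  suff: (p ^ n <= n)%N by rewrite leqNgt ltn_expl.
  by rewrite {2}/n abE abszM abszX absz_nat leq_pmull// absz_gt0.
- move=> [x y] U /padic_nbhsP[n Un].
  exists ([set x + k * p%:Z ^+ n | k in [set: int]],
          [set y + k * p%:Z ^+ n | k in [set: int]]).
    by split; apply/padic_nbhsP; exists n => k; exists k.
  move=> [u v] /= [[k _ <-] [l _ <-]].
  have -> : x + k * p%:Z ^+ n - (y + l * p%:Z ^+ n) = x - y + (k - l) * p%:Z ^+ n.
    by ring.
  exact: Un.
- move=> U /padic_nbhsP[n Un]; exists n => // m /= nm.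
  by have := Un (p%:Z ^+ (m - n)); rewrite add0r -exprD subnK.
Qed.

End padic.

Lemma Zseq_hausdorff (p : nat) : (1 < p)%N -> hausdorff_space (Zseq p).
Proof.
move=> /padic_admissible aT x y xy.
have [hT _ _] := aT; apply: hT => A B xA yB.
by apply: xy; exact: (Zseq_finer aT).
Qed.

Section identification.
Variables (R : realType) (p : nat).

Definition eval1 (chi : character R (Zseq p)) : torus R := chi (1 : int).

Lemma eval1_is_zmod_morphism : zmod_morphism eval1.
Proof. by []. Qed.
HB.instance Definition _ :=
  GRing.isZmodMorphism.Build _ _ eval1 eval1_is_zmod_morphism.

(* Z[1/p], as the smallest subring of R containing 1/p *)
Definition Zinv : set R :=
  smallest (fun S : set R => subring_closed [in S]) [set p%:R^-1].

Definition Zinv_mod_Z : set (torus R) := (\pi_(torus R) : R -> torus R) @` Zinv.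
End identification.
Arguments eval1 : clear implicits.
Arguments Zinv : clear implicits.
Arguments Zinv_mod_Z : clear implicits.

(* Main.v *)
Require Import Defs.
From HB Require Import structures.
From mathcomp Require Import all_boot all_order all_algebra.
From mathcomp Require Import generic_quotient ring_quotient.
From mathcomp Require Import ring zify.
From mathcomp Require Import all_classical all_reals all_analysis.

Set Implicit Arguments.
Unset Strict Implicit.
Unset Printing Implicit Defensive.

Import Order.TTheory GRing.Theory Num.Theory.
Import numFieldNormedType.Exports.

Local Open Scope classical_set_scope.
Local Open Scope ring_scope.
Local Open Scope quotient_scope.

(** Two facts about Z{p^n} carry the proof: it is finer than the p-adic
    topology, and p^n tends to 0 in it.

    Because it is finer than the p-adic topology, the subgroups p^m Z are open,
    hence closed, and every homomorphism that vanishes on some p^m Z is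
    continuous.  So every p-power torsion element y of the torus is the value
    at 1 of a character, namely k |-> k y ([torsion_character]).

    Because p^n tends to 0, there is nothing else.  A closed subgroup H that
    contains h <> 0 has finite index, hence is open, hence contains some p^n;
    Bezout then shows that H is generated by the least power of p in it
    ([closed_subgroup_Zseq]).  And if chi is a character, then p^n chi(1) tends
    to 0 in the torus.  The torus has a neighbourhood of 0 in which
    no nonzero point stays under repeated multiplication by p, so
    p^n chi(1) = 0 for some n ([torus_expn_cvg0_torsion]), which says that
    chi(1) is in Z[1/p]/Z.

    X(1): the character k |-> k / p^m separates p^m Z from the integers outside
    it, and {0} is the intersection of the p^m Z.  X(2): a character of p^m Z is
    determined by its value at p^m, which is p-power torsion by the same
    argument as above; any p^m-th part of this value is again p-power torsion,
    and defines an extension. *)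

(** * The torus *)

Lemma torus_pi0 (R : realType) : \pi_(torus R) (0 : R) = 0 :> torus R.
Proof. exact: (raddf0 (\pi_(torus R) : R -> _)). Qed.

Lemma torus_pi_eq0 (R : realType) (x : R) :
  (\pi_(torus R) x = 0 :> torus R) <-> (x \is a Num.int).
Proof. by rewrite -torus_pi0 torus_pi_eq subr0. Qed.

Lemma torus_piMn (R : realType) (x : R) n :
  \pi_(torus R) (x *+ n) = (\pi_(torus R) x : torus R) *+ n.
Proof. exact: (raddfMn (\pi_(torus R) : R -> torus R)). Qed.

Lemma torus_piMz (R : realType) (x : R) k :
  \pi_(torus R) (x *~ k) = (\pi_(torus R) x : torus R) *~ k.
Proof. exact: (raddfMz (\pi_(torus R) : R -> torus R)). Qed.

Lemma torus_divisible (R : realType) (n : nat) (y : torus R) :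
  (0 < n)%N -> exists z : torus R, z *+ n = y.
Proof.
move=> n0; exists (\pi_(torus R) (repr y / n%:R)).
rewrite -torus_piMn -(mulr_natr (_ / _)) divfK; first exact: reprK.
by rewrite pnatr_eq0 -lt0n.
Qed.

Lemma int_norm_lt1 (R : realType) (x : R) :
  x \is a Num.int -> `|x| < 1 -> x = 0.
Proof.
move=> /intrP[k ->]; rewrite -intr_norm ltrz1 => k1.
have -> : k = 0 by lia.
by [].
Qed.

(** Near 0 the multiplication by p of the torus is the expanding map
    r |-> p r of the line, so an orbit that stays near 0 is constantly 0. *)
Lemma torus_expn_cvg0_torsion (R : realType) (p : nat) (y : torus R) :
  (1 < p)%N -> (fun n => y *+ p ^ n) @ \oo --> (0 : torus R) ->
  exists n, y *+ p ^ n = 0.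
Proof.
(* With e = 1 / (p + 1), two representatives r, s with |r|, |s| < e satisfy
   |s - p r| < 1, so that s = p r as soon as both sides agree modulo Z. *)
move=> p1 ycv; pose e : R := (p%:R + 1)^-1.
have e0 : 0 < e by rewrite invr_gt0 ltr_wpDl.
have : nbhs (0 : torus R) ((\pi_(torus R) : R -> _) @` ball 0 e).
  apply: open_nbhs_nbhs; split; first exact/torus_pi_open/ball_open.
  by exists 0; [exact: ballxx|exact: torus_pi0].
move=> /ycv[N _ small].
have {small} small j : {r : R | `|r| < e & \pi_(torus R) r = y *+ p ^ (N + j)}.
  apply: cid2; have [r] := small (N + j)%N (leq_addr _ _).
  by rewrite -ball_normE /= sub0r normrN => re rE; exists r.
pose r j := s2val (small j).
have rlt j : `|r j| < e by rewrite /r; case: (small j).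
have rE j : \pi_(torus R) (r j) = y *+ p ^ (N + j).
  by rewrite /r; case: (small j).
have rS j : r j.+1 = r j *+ p.
  apply/subr0_eq/int_norm_lt1.
    by apply/torus_pi_eq; rewrite torus_piMn !rE addnS expnSr mulrnA.
  rewrite (le_lt_trans (ler_normB _ _))// normrMn -(mulr_natr `|_|).
  rewrite [ltRHS](_ : 1 = e + e * p%:R).
    by rewrite ltr_leD// ler_wpM2r// ltW.
  by rewrite /e; field; rewrite gt_eqF// ltr_wpDl.
have rX j : r j = r 0%N *+ p ^ j.
  by elim: j => [|j IH]; rewrite ?expn0 ?mulr1n// rS IH expnSr mulrnA.
(* A nonzero r 0 would give the unbounded orbit p^j (r 0). *)
exists N; rewrite -[N]addn0 -rE.
suff -> : r 0%N = 0 by exact: torus_pi0.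
apply/eqP; apply: contraT => r0.
have n0 : 0 < `|r 0%N| by rewrite normr_gt0.
pose j := Num.bound (e / `|r 0%N|).
have := rlt j; rewrite rX normrMn -(mulr_natr `|_|) ltNge => /negP[].
rewrite -ler_pdivrMl// mulrC.
apply: (le_trans (ltW (archi_boundP _))); first by rewrite divr_ge0// ltW.
by rewrite ler_nat ltnW// ltn_expl.
Qed.

(** The right-hand side is a subring containing 1/p; conversely, its elements
    are the k (1/p)^n with k an integer. *)
Lemma Zinv_expP (R : realType) (p : nat) : (0 < p)%N ->
  Zinv R p = [set x : R | exists n, x *+ p ^ n \is a Num.int].
Proof.
move=> p0; have p0R : p%:R != 0 :> R by rewrite pnatr_eq0 -lt0n.
apply/seteqP; split => x /=.
  move/(_ [set x : R | exists n, x *+ p ^ n \is a Num.int]); apply.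
  split; last first.
    by move=> _ ->; exists 1%N; rewrite expn1 -(mulr_natr (_^-1)) mulVf.
  split=> [|u v|u v]; rewrite !inE => /=; first by exists 0%N.
    move=> [m um] [n vn]; exists (m + n)%N.
    rewrite mulrnBl {1}expnD mulrnA addnC expnD mulrnA.
    by rewrite rpredB// rpredMn.
  move=> [m um] [n vn]; exists (m + n)%N.
  by rewrite expnD mulrnA -mulrnAl -mulrnAr rpredM.
move=> [n /intrP[k xk]] S [[S1 SB SM] Sp].
have {}Sp : p%:R^-1 \in S by rewrite inE; exact: Sp.
have -> : x = k%:~R * p%:R^-1 ^+ n.
  by rewrite -xk -(mulr_natr x) natrX -mulrA -exprMn divff// expr1n mulr1.
rewrite -inE.
have [S0 SD SN] : [/\ 0 \in S, {in S &, forall u v, u + v \in S}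
    & {in S, forall u, - u \in S}].
  have S0 : 0 \in S by rewrite -(subrr 1) SB.
  have SN u : u \in S -> - u \in S by move=> Su; rewrite -sub0r SB.
  by split=> // u v Su Sv; rewrite -[v]opprK SB// SN.
have Sn j : j%:R \in S.
  by elim: j => [//|j IH]; rewrite -natr1 SD.
rewrite SM//; last by elim: n {xk} => [//|n IH]; rewrite exprS SM.
by case: k {xk} => j; rewrite ?NegzE ?mulrNz; [exact: Sn|exact/SN/Sn].
Qed.

(** * Subgroups of the integers *)

Lemma Posz_expn (m n : nat) : (m ^ n)%N%:Z = m%:Z ^+ n.
Proof. by rewrite -!natz natrX. Qed.

Lemma zmod_morphism_mulrz (V : zmodType) (f : int -> V) :
  zmod_morphism f -> forall k, f k = f 1 *~ k.
Proof.
move=> fB k; pose F : {additive int -> V} :=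
    HB.pack f (GRing.isZmodMorphism.Build _ _ f fB).
by rewrite -{1}[k]intz; exact: (raddfMz F k 1).
Qed.

Lemma subgroupP (G : topologicalZmodType) (H : set G) :
  subgroup H <-> H 0 /\ forall x y, H x -> H y -> H (x - y).
Proof.
split=> [[H0 HB]|[H0 HB]]; split=> [|x y]; rewrite ?inE => //.
- exact: set_mem H0.
- by move=> Hx Hy; apply/set_mem/HB; exact: mem_set.
- exact: HB.
Qed.

Lemma subgroup_opp (G : topologicalZmodType) (H : set G) x :
  subgroup H -> H x -> H (- x).
Proof. by move=> /subgroupP[H0 HB] Hx; rewrite -sub0r; exact: HB. Qed.

Lemma subgroup_add (G : topologicalZmodType) (H : set G) x y :
  subgroup H -> H x -> H y -> H (x + y).
Proof.
move=> sH Hx /(subgroup_opp sH) Hy; have /subgroupP[_ HB] := sH.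
by rewrite -[y]opprK; exact: HB.
Qed.

Lemma subgroup_mulz (p : nat) (H : set (Zseq p)) (k h : int) :
  subgroup H -> H h -> H (k * h).
Proof.
move=> sH Hh; have /subgroupP[H0 _] := sH.
have Hn (j : nat) : H (j%:Z * h : Zseq p).
  elim: j => [|j IH]; first by rewrite mul0r.
  by rewrite intS mulrDl mul1r; exact: (subgroup_add sH).
by case: k => j; rewrite ?NegzE ?mulNr; [exact: Hn|exact/(subgroup_opp sH)/Hn].
Qed.

(** * Closed subgroups *)

(** The topology is finer than the p-adic one, for which this is clear. *)
Lemma Zseq_nbhs_expM (p n : nat) (x : Zseq p) : (1 < p)%N ->
  nbhs x [set x + p%:Z ^+ n * k | k in [set: int]].
Proof.
move=> p1; apply: (Zseq_finer (padic_admissible p1)).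
by apply/padic_nbhsP; exists n => k; exists k => //; rewrite mulrC.
Qed.

Lemma Zseq_closed_expM (p n : nat) : (1 < p)%N ->
  closed ([set p%:Z ^+ n * k | k in [set: int]] : set (Zseq p)).
Proof.
move=> p1 x /(_ _ (Zseq_nbhs_expM n x p1)) [_ [[k _ <-] [l _ E]]].
by exists (k - l) => //; rewrite mulrBr -E addrK.
Qed.

(** H contains h Z, so its complement is the union of the finitely many closed
    cosets r + H with 0 <= r < |h| and r not in H.  It is therefore closed, and
    the sequence p^n, which tends to 0, eventually leaves it. *)
Lemma closed_subgroup_expn (p : nat) (H : set (Zseq p)) (h : int) :
  subgroup H -> closed H -> h != 0 -> H h -> exists n, H (p%:Z ^+ n).
Proof.
move=> sH clH h0 Hh; have /subgroupP[H0 HB] := sH.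
(* Near 0, x cannot lie in r + H unless this coset is H itself. *)
have nearH (r : 'I_`|h|) :
    \forall x \near (0 : Zseq p), H (x - (r : nat)%:Z) -> H (r : nat)%:Z.
  have [Hr|nHr] := pselect (H (r : nat)%:Z); first exact: filterE.
  have nHNr : (~` H) (0 - (r : nat)%:Z : Zseq p).
    move=> HNr; apply: nHr.
    have -> : (r : nat)%:Z = 0 - (0 - (r : nat)%:Z) by rewrite !sub0r opprK.
    by apply: HB => //; exact: HB.
  have [[/= A B] [A0 Br] AB] := @Zseq_sub_continuous p (0, (r : nat)%:Z) _
    (open_nbhs_nbhs (conj (closed_openC clH) nHNr)).
  apply: filterS A0 => x Ax HxB.
  by case: (AB (x, (r : nat)%:Z) (conj Ax (nbhs_singleton Br))).
have := @Zseq_cvg p _ (filter_forall _ nearH) => -[N _ /(_ N (leqnn N)) /= HN].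
exists N; set x := p%:Z ^+ N in HN *.
have rh : (`|(x %% h)%Z| < `|h|)%N.
  by rewrite -ltz_nat gez0_abs ?modz_ge0// ltz_mod.
have := HN (Ordinal rh) => /=; rewrite gez0_abs ?modz_ge0//.
have Hq : H ((x %/ h)%Z * h) by exact: subgroup_mulz.
rewrite {1}(divz_eq x h) addrK => /(_ Hq) Hr.
by rewrite (divz_eq x h); exact: (subgroup_add sH).
Qed.

(** If p^m is the least power of p in H and x is in H, then the gcd of x and p^m
    is in H by Bezout; it is a power of p, so it is p^m, which thus divides
    x. *)
Lemma closed_subgroup_Zseq (p : nat) (H : set (Zseq p)) :
  prime p -> subgroup H -> closed H ->
  H = [set 0] \/ exists m, H = [set p%:Z ^+ m * k | k in [set: int]].
Proof.
move=> pp sH clH; have /subgroupP[H0 _] := sH.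
have [[h [Hh /eqP h0]]|Htriv] := pselect (exists h, H h /\ h <> 0); last first.
  left; apply/seteqP; split => [x Hx|_ ->]; last by [].
  by apply: contrapT => x0; apply: Htriv; exists x.
right; have [n Hn] := closed_subgroup_expn sH clH h0 Hh.
have exm : exists m, `[< H (p%:Z ^+ m) >] by exists n; exact/asboolP.
case: (ex_minnP exm) => m /asboolP Hm minm; exists m.
apply/seteqP; split => [x Hx|_ [k _ <-]]; last first.
  by rewrite mulrC; exact: subgroup_mulz.
have Hg : H (gcdz x (p%:Z ^+ m)).
  have [u [v <-]] := Bezoutz x (p%:Z ^+ m).
  by apply: (subgroup_add sH) => //; exact: subgroup_mulz.
have /(dvdn_pfactor _ _ pp)[i im gE] : (gcdn `|x| (p ^ m) %| p ^ m)%N.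
  exact: dvdn_gcdr.
have mi : (m <= i)%N.
  apply: minm; apply/asboolP; rewrite -Posz_expn -gE.
  by move: Hg; rewrite /gcdz -Posz_expn.
have /dvdzP[k xk] : (p%:Z ^+ m %| x)%Z.
  rewrite -Posz_expn dvdzE /= (_ : m = i) -?gE ?dvdn_gcdl//.
  by apply/eqP; rewrite eqn_leq mi im.
by exists k => //; rewrite mulrC xk.
Qed.

Lemma Zseq_closed_subgroupP (p : nat) (H : set (Zseq p)) : prime p ->
  subgroup H /\ closed H <->
  (exists m : nat, H = [set p%:Z ^+ m * k | k in [set: int]]) \/ H = [set 0].
Proof.
move=> pp; split=> [[sH clH]|].
  by have [->|[m ->]] := closed_subgroup_Zseq pp sH clH; [right|left; exists m].
move=> [[m ->]|->]; split.
- split=> [|x y]; rewrite !inE; first by exists 0; rewrite ?mulr0.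
  by move=> [k _ <-] [l _ <-]; exists (k - l) => //; rewrite mulrBr.
- exact/Zseq_closed_expM/prime_gt1.
- by split=> [|x y]; rewrite !inE => //= -> ->; rewrite subr0.
- exact/accessible_closed_set1/hausdorff_accessible/Zseq_hausdorff/prime_gt1.
Qed.

(** * Characters *)

Lemma Zseq_periodic_continuous (p : nat) (V : topologicalType)
    (f : Zseq p -> V) (n : nat) : (1 < p)%N ->
  (forall x k, f (x + p%:Z ^+ n * k) = f x) -> continuous f.
Proof.
move=> p1 fE x U Ux; apply: filterS (Zseq_nbhs_expM n x p1) => _ [k _ <-] /=.
by rewrite fE; exact: nbhs_singleton Ux.
Qed.

Lemma torsion_character (R : realType) (p : nat) (y : torus R) (n : nat) :
  (1 < p)%N -> y *+ p ^ n = 0 ->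
  exists chi : character R (Zseq p), forall k, chi k = y *~ k.
Proof.
move=> p1 yn0; pose f (k : Zseq p) := y *~ (k : int).
have fP : character_pred f.
  apply/asboolP; split; first by move=> k l; exact: mulrzBr.
  apply: (Zseq_periodic_continuous (n := n)) p1 _ => x k; rewrite /f.
  by rewrite mulrzDr mulrzA -Posz_expn -pmulrn yn0 mul0rz addr0.
by exists (Character fP).
Qed.

(** The multiples of p^m by p^n lie in H and tend to 0 in H, so p^n f(p^m) tends
    to f(0) = 0, and f(p^m) is p-power torsion. *)
Lemma subgroup_character_torsion (R : realType) (p : nat) (H : set (Zseq p))
    (f : Zseq p -> torus R) (m : nat) : (1 < p)%N ->
  (forall k, H (p%:Z ^+ m * k)) ->
  subgroup_character H f ->
  exists2 n, f (p%:Z ^+ m) *+ p ^ n = 0 &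
    forall k, f (p%:Z ^+ m * k) = f (p%:Z ^+ m) *~ k.
Proof.
move=> p1 Hm [fB /subspace_continuousP fC].
have fE k : f (p%:Z ^+ m * k) = f (p%:Z ^+ m) *~ k.
  rewrite -[in RHS](mulr1 (_ ^+ m)).
  apply: (@zmod_morphism_mulrz _ (fun k => f (p%:Z ^+ m * k))) => u v.
  by rewrite mulrBr fB ?inE.
have [|n fn0] := @torus_expn_cvg0_torsion R p (f (p%:Z ^+ m)) p1;
  last by exists n.
have f0 : f 0 = 0 by rewrite -(mulr0 (p%:Z ^+ m)) fE.
have H0 : H 0 by rewrite -(mulr0 (p%:Z ^+ m)).
rewrite -f0 => U /(fC 0 H0) /(@Zseq_cvg p) [N _ NU].
exists N => // n Nn /=.
rewrite pmulrn Posz_expn -fE -exprD.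
apply: (NU (m + n)%N); first exact: leq_trans (leq_addl _ _).
by rewrite exprD; exact: Hm.
Qed.

Lemma character_mulrz (R : realType) (p : nat) (chi : character R (Zseq p)) k :
  chi k = eval1 R p chi *~ k.
Proof.
have /asboolP[chiB _] := character_funP chi.
exact: zmod_morphism_mulrz.
Qed.

Lemma eval1_inj (R : realType) (p : nat) : injective (eval1 R p).
Proof.
move=> chi psi E; apply/val_inj/funext => k.
by rewrite /= !character_mulrz E.
Qed.

Lemma range_eval1 (R : realType) (p : nat) : (1 < p)%N ->
  range (eval1 R p) = Zinv_mod_Z R p.
Proof.
move=> p1; have p0 := ltnW p1.
rewrite /Zinv_mod_Z Zinv_expP//; apply/seteqP; split => y /=.
  move=> [chi _ <-]; have /asboolP[chiB chiC] := character_funP chi.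
  have [|n n0 _] := @subgroup_character_torsion R p setT chi 0%N p1 (fun=> I).
    by split=> [x y' _ _|]; [exact: chiB|exact: continuous_subspaceT].
  exists (repr (eval1 R p chi)); last exact: reprK.
  by exists n; apply/torus_pi_eq0; rewrite torus_piMn reprK.
move=> [x [n xn] <-].
have [|chi chiE] := @torsion_character R p (\pi_(torus R) x) n p1.
  by rewrite -torus_piMn; apply/torus_pi_eq0.
by exists chi => //; rewrite /eval1 chiE.
Qed.

(** * Dually closed and dually embedded subgroups *)

(** The character is k |-> k / p^m mod Z. *)
Lemma character_separation (R : realType) (p m : nat) (g : int) :
  (1 < p)%N -> ~ (p%:Z ^+ m %| g)%Z ->
  exists chi : character R (Zseq p),
    (forall k, chi (p%:Z ^+ m * k) = 0) /\ chi g <> 0.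
Proof.
move=> p1 ndvd.
have pm0 : (p ^ m)%:R != 0 :> R.
  by rewrite pnatr_eq0 -lt0n expn_gt0 ltnW.
have inv0 : \pi_(torus R) ((p ^ m)%:R^-1) *+ p ^ m = 0.
  by rewrite -torus_piMn -(mulr_natr (_^-1)) mulVf//; apply/torus_pi_eq0.
have [chi chiE] := torsion_character p1 inv0; exists chi; split.
  by move=> k; rewrite chiE mulrzA -Posz_expn -pmulrn inv0 mul0rz.
rewrite chiE -torus_piMz => /torus_pi_eq0/intrP[k gk]; apply: ndvd.
apply/dvdzP; exists k; apply/eqP; rewrite -(eqr_int R) -Posz_expn intrM -gk.
by rewrite -(mulrzr (_^-1)) mulrAC mulVf// mul1r.
Qed.

Lemma Zseq_X1 (R : realType) (p : nat) : prime p -> property_X1 R (Zseq p).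
Proof.
move=> pp H sH clH g Hg; have p1 := prime_gt1 pp.
have [HE|[m HE]] := closed_subgroup_Zseq pp sH clH.
  have g0 : (g : int) != 0 by apply/eqP => g0; apply: Hg; rewrite HE.
  (* p^|g| > |g|, so that p^|g| does not divide g. *)
  have [|chi [_ chig]] := @character_separation R p `|(g : int)|%N g p1.
    rewrite -Posz_expn dvdzE /= => /dvdn_leq; rewrite absz_gt0 => /(_ g0).
    by rewrite leqNgt ltn_expl.
  by exists chi; split=> // h; rewrite HE => ->; rewrite character_mulrz mulr0z.
have [|chi [chiH chig]] := @character_separation R p m g p1.
  move=> /dvdzP[k gk]; apply: Hg; rewrite HE.
  by exists k => //; rewrite mulrC gk.
by exists chi; split=> // h; rewrite HE => -[k _ <-].
Qed.

Lemma Zseq_X2 (R : realType) (p : nat) : prime p -> property_X2 R (Zseq p).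
Proof.
move=> pp H sH clH f fH; have p1 := prime_gt1 pp.
have [HE|[m HE]] := closed_subgroup_Zseq pp sH clH.
  exists 0 => h; rewrite HE => ->; have [fB _] := fH.
  have H0 : 0 \in H by case: sH.
  by have := fB 0 0 H0 H0; rewrite !subrr => ->.
have Hm k : H (p%:Z ^+ m * k) by rewrite HE; exists k.
have [n yn fE] := subgroup_character_torsion p1 Hm fH.
have pm0 : (0 < p ^ m)%N by rewrite expn_gt0 ltnW.
have [z zy] := torus_divisible (f (p%:Z ^+ m)) pm0.
have [|chi chiE] := @torsion_character R p z (m + n) p1.
  by rewrite expnD mulrnA zy.
exists chi => h; rewrite HE => -[k _ <-].
by rewrite chiE fE mulrzA -zy pmulrn Posz_expn.
Qed.

Theorem proposition2p2 (R : realType) (p : nat) (p_prime : prime p) :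
  [/\ (forall H : set (Zseq p),
         subgroup H /\ closed H <->
         (exists m : nat, H = [set p%:Z ^+ m * k | k in [set: int]]) \/
         H = [set 0]),
      [/\ zmod_morphism (eval1 R p),
          injective (eval1 R p) &
          range (eval1 R p) = Zinv_mod_Z R p],
      property_X1 R (Zseq p) &
      property_X2 R (Zseq p)].
Proof.
split; [move=> H; exact: Zseq_closed_subgroupP| |exact: Zseq_X1|exact: Zseq_X2].
split; [exact: eval1_is_zmod_morphism|exact: eval1_inj|].
exact/range_eval1/prime_gt1.
Qed.
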